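(* Let $d\ge 1$, $c>0$, $h=1/n$ with $n\ge 2$ a power of $2$, and let $A_h^{D}$, $A_h^{P}$, $A_{2h}^{D}$, $A_{2h}^{P}$ be the Dirichlet and periodic matrices, $S_h^{D}$, $S_h^{P}$ the smoothers, $I_{h,2h}^{D}$, $I_{h,2h}^{P}$ the restriction operators, $I_{2h,h}^{D}$, $I_{2h,h}^{P}$ the prolongation operators, and $B_h^D$, $B_h^P$ the multigrid iterators, all as defined in the context. If the pairs $(A_h^D,A_h^P)$, $((A_{2h}^D)^{-1},(A_{2h}^P)^{-1})$, $(S_h^D,S_h^P)$, $(I_{2h,h}^D,I_{2h,h}^P)$ and $(I_{h,2h}^D,I_{h,2h}^P)$ are LFA-compatible, then $(B_h^D,B_h^P)$ is LFA-compatible.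
   Context: Let $\bm{e}_k^m$ be the $k$-th canonical basis vector of $\mathbb{R}^m$, $I_m$ the $m\times m$ identity ($I$ without a numerical index denotes the identity of the appropriate size), $\otimes$ the Kronecker (tensor) product of matrices, and $X^{\otimes k}$ the $k$-fold tensor power of $X$. Let $\operatorname{diag}(-1,2,-1)$ denote the square tridiagonal matrix (of the indicated size) with $2$ on the diagonal and $-1$ on the sub- and superdiagonals. For a step size $\eta=1/m$ with $m\in\mathbb{N}$, $m\ge 1$, put $M=2m$. Dirichlet matrix: $T_\eta^D=\frac{1}{\eta^2}\operatorname{diag}(-1,2,-1)\in\mathbb{R}^{(m-1)\times(m-1)}$ and $$A_\eta^D=\sum_{j=1}^d\left(I_{m-1}^{\otimes(j-1)}\otimes T_\eta^D\otimes I_{m-1}^{\otimes(d-j)}\right)+c\,I_{m-1}^{\otimes d}\in\mathbb{R}^{(m-1)^d\times(m-1)^d}.$$ Periodic matrix: $T_\eta^P=\frac{1}{\eta^2}\left(\operatorname{diag}(-1,2,-1)-\bm{e}_1^M(\bm{e}_M^M)^T-\bm{e}_M^M(\bm{e}_1^M)^T\right)\in\mathbb{R}^{M\times M}$ and $$A_\eta^P=\sum_{j=1}^d\left(I_M^{\otimes(j-1)}\otimes T_\eta^P\otimes I_M^{\otimes(d-j)}\right)+c\,I_M^{\otimes d}\in\mathbb{R}^{M^d\times M^d}.$$ Odd extension operator: the linear map $E_{o,\eta}:\mathbb{R}^{m-1}\to\mathbb{R}^M$ with $E_{o,\eta}\bm{e}_i^{m-1}=\bm{e}_i^M-\bm{e}_{M-i}^M$,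 $i=1,\ldots,m-1$. Its associated restriction is $R_{o,\eta}=\frac12E_{o,\eta}^T$. In dimension $d$ one uses $E_{o,\eta}^{\otimes d}$ and $R_{o,\eta}^{\otimes d}$. If $m=1$, $\mathbb{R}^{m-1}$ is the zero space and operators on it are trivial. Grid functions at step size $\eta=1/m$ are identified with $\mathcal{G}_\eta^D=\mathbb{R}^{(m-1)^d}$ (Dirichlet, values at interior points) and $\mathcal{G}_\eta^P=\mathbb{R}^{(2m)^d}$ (periodic). Smoothers $S_\eta^{D}$, $S_\eta^{P}$ are linear operators on $\mathcal{G}_\eta^{D}$, $\mathcal{G}_\eta^{P}$ respectively. For $m$ even, restriction operators $I_{\eta,2\eta}^{D}$, $I_{\eta,2\eta}^{P}$ are linear maps $\mathcal{G}_\eta^{D}\to\mathcal{G}_{2\eta}^{D}$, $\mathcal{G}_\eta^{P}\to\mathcal{G}_{2\eta}^{P}$, and prolongation operators $I_{2\eta,\eta}^{D}$, $I_{2\eta,\eta}^{P}$ are linear maps $\mathcal{G}_{2\eta}^{D}\to\mathcal{G}_\eta^{D}$, $\mathcal{G}_{2\eta}^{P}\to\mathcal{G}_\eta^{P}$. Iterators (each formula is read with all operators carrying the superscript $D$, or all carrying $P$). The two-grid iterator is $$B_{TG}=\Big(I-\big(I-I_{2h,h}(A_{2h})^{-1}I_{h,2h}A_h\big)\big(I-S_hA_h\big)\Big)(A_h)^{-1}.$$ The multigrid iterator $B_h$ is obtained from the two-grid one by recursion, namely $$B_h=\Big(I-\big(I-I_{2h,h}B_{2h}I_{h,2h}A_h\big)\big(I-S_hA_h\big)\Big)(A_h)^{-1},$$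 where $B_{2h}$ is defined by the same formula with $h$ replaced by $2h$, and so on through the step sizes $4h,8h,\ldots$, the recursion ending with $B_{nh}=A_{nh}^{-1}$ for both the Dirichlet and the periodic problem. LFA-compatibility: (i) A pair $(M_\eta^D,M_\eta^P)$ of linear operators on $\mathcal{G}_\eta^D$ and $\mathcal{G}_\eta^P$ is LFA-compatible if and only if $M_\eta^D=R_{o,\eta}^{\otimes d}M_\eta^PE_{o,\eta}^{\otimes d}$ and $M_\eta^P\bm{v}\in\operatorname{range}(E_{o,\eta}^{\otimes d})$ for all $\bm{v}\in\operatorname{range}(E_{o,\eta}^{\otimes d})$. (ii) A pair of restrictions $(I_{h,2h}^D,I_{h,2h}^P)$ is LFA-compatible if and only if $I_{h,2h}^D=R_{o,2h}^{\otimes d}I_{h,2h}^PE_{o,h}^{\otimes d}$ and $I_{h,2h}^P\bm{v}\in\operatorname{range}(E_{o,2h}^{\otimes d})$ for all $\bm{v}\in\operatorname{range}(E_{o,h}^{\otimes d})$. (iii) A pair of prolongations $(I_{2h,h}^D,I_{2h,h}^P)$ is LFA-compatible if and only if $I_{2h,h}^D=R_{o,h}^{\otimes d}I_{2h,h}^PE_{o,2h}^{\otimes d}$ and $I_{2h,h}^P\bm{v}\in\operatorname{range}(E_{o,h}^{\otimes d})$ for all $\bm{v}\in\operatorname{range}(E_{o,2h}^{\otimes d})$.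
   Formalization: LFA-compatibility of the smoother, prolongation and restriction pairs is assumed at every level of the multigrid recursion, not only at step size h; for n ≥ 4 the claim fails if it is assumed only at h, since the smoothers at 2h would be unrelated. *)

(* Defs.v *)
From mathcomp Require Import all_boot all_order all_algebra.
From mathcomp Require Export mxtens.
From mathcomp Require Import reals.

Set Implicit Arguments.
Unset Strict Implicit.
Unset Printing Implicit Defensive.

Import GRing.Theory.
Local Open Scope ring_scope.

(* Linear maps are matrices acting on column vectors. The grid of step size
   1/m has m.-1 (Dirichlet) or 2 * m (periodic) points in each direction. *)

Section GridOperators.

Variable R : realType.

(* k-th canonical basis vector, with the indices k running from 1 to m *)
Definition basis_vec (m k : nat) : 'cV[R]_m := \col_i ((i.+1 == k)%N)%:R.

Definition tridiag (m : nat) : 'M[R]_m :=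
  \matrix_(i, j) (if i == j then 2
                  else if (i.+1 == j :> nat) || (j.+1 == i :> nat) then -1
                  else 0).

Definition step (m : nat) : R := 1 / m%:R.

Definition T_D (m : nat) : 'M[R]_(m.-1) :=
  (1 / step m ^+ 2) *: tridiag m.-1.

Definition T_P (m : nat) : 'M[R]_(2 * m) :=
  let M := (2 * m)%N in
  (1 / step m ^+ 2) *: (tridiag M
    - basis_vec M 1 *m (basis_vec M M)^T
    - basis_vec M M *m (basis_vec M 1)^T).

Lemma tens_slot_size (s d : nat) (j : 'I_d) :
  (s ^ j * s * s ^ (d - j.+1) = s ^ d)%N.
Proof. by rewrite -expnSr -expnD subnKC. Qed.

(* I^(⊗j) ⊗ T ⊗ I^(⊗(d-1-j)), where j : 'I_d is counted from 0 *)
Definition tens_slot (s d : nat) (T : 'M[R]_s) (j : 'I_d) : 'M[R]_(s ^ d) :=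
  castmx (tens_slot_size s j, tens_slot_size s j)
    (((1%:M : 'M[R]_s) ^t j) *t T *t ((1%:M : 'M[R]_s) ^t (d - j.+1))).

Definition kron_sum (d : nat) (c : R) (s : nat) (T : 'M[R]_s) :
    'M[R]_(s ^ d) :=
  \sum_(j < d) tens_slot T j + c *: ((1%:M : 'M[R]_s) ^t d).

Definition A_D (d : nat) (c : R) (m : nat) : 'M[R]_(m.-1 ^ d) :=
  kron_sum d c (T_D m).

Definition A_P (d : nat) (c : R) (m : nat) : 'M[R]_((2 * m) ^ d) :=
  kron_sum d c (T_P m).

(* Column i : 'I_(m.-1) is the image of the basis vector of index i.+1. *)
Definition odd_ext (m : nat) : 'M[R]_(2 * m, m.-1) :=
  \matrix_(r, i) (basis_vec (2 * m) i.+1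
                  - basis_vec (2 * m) (2 * m - i.+1)) r 0.

Definition odd_restr (m : nat) : 'M[R]_(m.-1, 2 * m) :=
  2^-1 *: (odd_ext m)^T.

Definition mx_range (p q : nat) (X : 'M[R]_(p, q)) (v : 'cV[R]_p) : Prop :=
  exists w : 'cV[R]_q, v = X *m w.

(* Operators from the grid of step size 1/m to the grid of step size 1/m';
   m' = m for matrices and smoothers, m = 2m' for restrictions, m' = 2m for
   prolongations. *)
Definition lfa_compatible (d m m' : nat)
    (LD : 'M[R]_(m'.-1 ^ d, m.-1 ^ d))
    (LP : 'M[R]_((2 * m') ^ d, (2 * m) ^ d)) : Prop :=
  LD = odd_restr m' ^t d *m LP *m odd_ext m ^t d
  /\ (forall v : 'cV[R]_((2 * m) ^ d),
        mx_range (odd_ext m ^t d) v -> mx_range (odd_ext m' ^t d) (LP *m v)).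

(* Level k stands for the step size 1 / 2^k, N k is the number of grid points
   there, and level 0 is the coarsest one. Transfer operators are indexed by
   the coarser of their two levels. For A_D and A_P with c > 0, invmx is the
   genuine inverse, since T_D and T_P are positive semidefinite. *)
Fixpoint multigrid (N : nat -> nat)
    (A S : forall k, 'M[R]_(N k))
    (restr : forall k, 'M[R]_(N k, N k.+1))
    (prol : forall k, 'M[R]_(N k.+1, N k))
    (k : nat) : 'M[R]_(N k) :=
  match k with
  | 0 => invmx (A 0)
  | l.+1 =>
    (1%:M
     - (1%:M - prol l *m multigrid A S restr prol l *m restr l *m A l.+1)
       *m (1%:M - S l.+1 *m A l.+1))
    *m invmx (A l.+1)
  end.

Definition B_D (d : nat) (c : R)
    (S : forall k, 'M[R]_((2 ^ k).-1 ^ d))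
    (restr : forall k, 'M[R]_((2 ^ k).-1 ^ d, (2 ^ k.+1).-1 ^ d))
    (prol : forall k, 'M[R]_((2 ^ k.+1).-1 ^ d, (2 ^ k).-1 ^ d))
    (k : nat) : 'M[R]_((2 ^ k).-1 ^ d) :=
  @multigrid (fun l => (2 ^ l).-1 ^ d)%N
    (fun l => A_D d c (2 ^ l)) S restr prol k.

Definition B_P (d : nat) (c : R)
    (S : forall k, 'M[R]_((2 * 2 ^ k) ^ d))
    (restr : forall k, 'M[R]_((2 * 2 ^ k) ^ d, (2 * 2 ^ k.+1) ^ d))
    (prol : forall k, 'M[R]_((2 * 2 ^ k.+1) ^ d, (2 * 2 ^ k) ^ d))
    (k : nat) : 'M[R]_((2 * 2 ^ k) ^ d) :=
  @multigrid (fun l => (2 * 2 ^ l) ^ d)%N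
    (fun l => A_P d c (2 ^ l)) S restr prol k.

End GridOperators.

(* Main.v *)
Require Import Defs.
From mathcomp Require Import all_boot all_order all_algebra.
From mathcomp Require Import reals zify ring.

(* On odd grid functions the periodic problem restricts to the Dirichlet one:
   writing E for the tensor power of the odd extension, compatibility of a pair
   (LD, LP) amounts to LP E = E LD, because the odd restriction is a left
   inverse of E. This relation passes to sums, products and inverses. The pair
   (A_D, A_P) satisfies it at every level, since the one-dimensional matrices
   do; and A_P is invertible because T_P = G^T G, with G a multiple of the
   cyclic difference matrix, makes A_P a sum of Gram matrices plus c I. The
   theorem follows by induction on the level. *)

Set Implicit Arguments.
Unset Strict Implicit.
Unset Printing Implicit Defensive.

Import Order.TTheory GRing.Theory Num.Theory.
Local Open Scope ring_scope.

(** * Product and exponent rules for tensor powers *)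

Section TensorPower.
Variable R : comPzRingType.

Lemma castmx_irr (T : Type) (m n m' n' : nat) (e e' : (m = m') * (n = n'))
    (A : 'M[T]_(m, n)) :
  castmx e A = castmx e' A.
Proof. by congr castmx; case: e e' => ? ? [? ?]; congr pair; apply: eq_irrelevance. Qed.

Lemma mulmx_castmx (m n p m' n' p' : nat) (em : m = m') (en : n = n') (ep : p = p')
    (A : 'M[R]_(m, n)) (B : 'M[R]_(n, p)) :
  castmx (em, en) A *m castmx (en, ep) B = castmx (em, ep) (A *m B).
Proof. by case: _ / em; case: _ / en; case: _ / ep; rewrite !castmx_id. Qed.

Lemma tensmx_castr (m n p q p' q' : nat) (e : (p = p') * (q = q'))
    (e' : (m * p = m * p')%N * (n * q = n * q')%N)
    (A : 'M[R]_(m, n)) (B : 'M[R]_(p, q)) :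
  A *t castmx e B = castmx e' (A *t B).
Proof.
case: e => e1 e2; case: _ / e1 e'; case: _ / e2 => e'.
by rewrite (castmx_irr e' (erefl, erefl)) !castmx_id.
Qed.

(** Both groupings split an index into the same three mixed-radix digits, read off as quotients and
    remainders. *)
Lemma tensmxA (m n p q r s : nat) (A : 'M[R]_(m, n)) (B : 'M[R]_(p, q))
    (C : 'M[R]_(r, s)) :
  A *t B *t C = castmx (mulnA m p r, mulnA n q s) (A *t (B *t C)).
Proof.
apply/matrixP => i j; rewrite castmxE !mxE /= mulrA.
congr (A _ _ * B _ _ * C _ _); apply: val_inj => /=.
- by rewrite -divnMA; congr (_ %/ _)%N; apply: mulnC.
- by rewrite -divnMA; congr (_ %/ _)%N; apply: mulnC.
- by rewrite modn_divl.
- by rewrite modn_divl.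
- by rewrite modn_dvdm ?dvdn_mull.
- by rewrite modn_dvdm ?dvdn_mull.
Qed.

Lemma ntensmxD (m n a b : nat) (A : 'M[R]_(m, n))
    (e : (m ^ a * m ^ b = m ^ (a + b))%N * (n ^ a * n ^ b = n ^ (a + b))%N) :
  castmx e (A ^t a *t A ^t b) = A ^t (a + b).
Proof.
(* [A ^t 1] is [A] itself rather than [A *t 1], hence two base cases. *)
elim: a e => [|[|a] IHa] [e1 e2].
- by rewrite ntensmx0 tens_scalar1mx castmx_comp castmx_id.
- case: b {IHa} e1 e2 => [|b] e1 e2; last by rewrite castmx_id.
  by rewrite ntensmx0 tens_mx_scalar scale1r castmx_comp castmx_id.
rewrite ntensmxSS tensmxA castmx_comp.
rewrite -[RHS]/(A *t A ^t (a.+1 + b)).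
rewrite -(IHa (esym (expnD _ _ _), esym (expnD _ _ _))).
rewrite (tensmx_castr _ (congr1 _ (esym (expnD _ _ _)), congr1 _ (esym (expnD _ _ _)))).
exact: castmx_irr.
Qed.

Lemma ntensmx_mul (m n p k : nat) (A : 'M[R]_(m, n)) (B : 'M[R]_(n, p)) :
  A ^t k *m B ^t k = (A *m B) ^t k.
Proof.
elim: k => [|[|k] IHk]; [exact: mulmx1 | by [] |].
by rewrite !ntensmxSS tensmx_mul IHk.
Qed.

Lemma tensmx11 (m n : nat) : 1%:M *t 1%:M = 1%:M :> 'M[R]_(m * n).
Proof.
apply/matrixP => i j.
case: (mxtens_indexP i) => i0 i1; case: (mxtens_indexP j) => j0 j1.
rewrite tensmxE !mxE (can_eq (@mxtens_indexK m n)) xpair_eqE /=.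
by rewrite -natrM mulnb.
Qed.

Lemma ntensmx_id (m k : nat) : (1%:M : 'M[R]_m) ^t k = 1%:M.
Proof. by elim: k => [|[|k] IHk] //; rewrite ntensmxSS IHk tensmx11. Qed.
End TensorPower.

(** * Intertwining and invertibility of Kronecker sums *)

Section KroneckerSum.
Variable R : realType.

(** Once [E ^t d] is split around slot [j], the mixed-product rule works slot by slot: [E] passes
    through the identities, and the hypothesis settles slot [j]. *)
Lemma tens_slot_intertwine (d p q : nat) (T : 'M[R]_p) (U : 'M[R]_q)
    (E : 'M[R]_(p, q)) (j : 'I_d) :
  T *m E = E *m U -> tens_slot T j *m E ^t d = E ^t d *m tens_slot U j.
Proof.
move=> TE.
have e s : ((s ^ (j + 1)) * s ^ (d - j.+1) = s ^ (j + 1 + (d - j.+1)))%N.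
  by rewrite -expnD.
have f s : ((s ^ j) * s ^ 1 = s ^ (j + 1))%N by rewrite -expnD.
have g s : (s ^ (j + 1 + (d - j.+1)) = s ^ d)%N by rewrite addn1 subnKC.
have -> : E ^t d = castmx (tens_slot_size p j, tens_slot_size q j)
                     (E ^t j *t E *t E ^t (d - j.+1)).
  have Ed b (h : b = d) (h' : (p ^ b = p ^ d)%N * (q ^ b = q ^ d)%N) :
    E ^t d = castmx h' (E ^t b).
    by case: d / h h' {e f g j} => h'; rewrite castmx_id.
  rewrite (Ed (j + 1 + (d - j.+1))%N _ (g p, g q)); last by rewrite addn1 subnKC.
  rewrite -(ntensmxD _ (e p, e q)) castmx_comp.
  rewrite -(ntensmxD _ (f p, f q)).
  (* Eliminating these size equalities removes the inner cast; the remaining casts differ only in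
     their proofs. *)
  case: _ / (f p) (e p); case: _ / (f q) (e q) => e1 e2.
  by rewrite castmx_id; apply: castmx_irr.
rewrite /tens_slot !mulmx_castmx; congr castmx.
by rewrite !tensmx_mul TE !ntensmx_mul !mulmx1 !mul1mx.
Qed.

Lemma kron_sum_intertwine (d p q : nat) (c : R) (T : 'M[R]_p) (U : 'M[R]_q)
    (E : 'M[R]_(p, q)) :
  T *m E = E *m U -> kron_sum d c T *m E ^t d = E ^t d *m kron_sum d c U.
Proof.
move=> TE; rewrite /kron_sum mulmxDl mulmxDr mulmx_suml mulmx_sumr; congr (_ + _).
  by apply: eq_bigr => j _; exact: tens_slot_intertwine.
by rewrite !ntensmx_id -scalemxAl -scalemxAr mul1mx mulmx1.
Qed.

Lemma tens_slot_gram (d p : nat) (G : 'M[R]_p) (j : 'I_d) :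
  tens_slot (G^T *m G) j = (tens_slot G j)^T *m tens_slot G j.
Proof.
rewrite /tens_slot trmx_cast /= mulmx_castmx; congr castmx.
by rewrite !trmx_tens !tensmx_mul !ntensmx_id !trmx1 !mul1mx.
Qed.

Lemma mulmx_tr_sum_sqr (S : pzSemiRingType) (n : nat) (v : 'rV[S]_n) :
  (v *m v^T) 0 0 = \sum_i v 0 i ^+ 2.
Proof. by rewrite mxE; apply: eq_bigr => i _; rewrite mxE expr2. Qed.

(* [v (c + \sum_j G_j^T G_j) v^T = c |v|^2 + \sum_j |v G_j^T|^2]. *)
Lemma kron_sum_gram_unitmx (d p : nat) (c : R) (G : 'M[R]_p) :
  0 < c -> kron_sum d c (G^T *m G) \in unitmx.
Proof.
move=> c0; rewrite -row_free_unit; apply/inj_row_free => v.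
move=> /(congr1 (fun X => (X *m v^T) 0 0)).
rewrite /kron_sum ntensmx_id mulmxDr mulmxDl mulmx_sumr mulmx_suml mul0mx mxE summxE [RHS]mxE.
under eq_bigr => j _.
  rewrite tens_slot_gram mulmxA -mulmxA -[X in _ *m (X *m _)]trmxK -trmx_mul mulmx_tr_sum_sqr.
  over.
rewrite -scalemxAr mulmx1 -scalemxAl mxE mulmx_tr_sum_sqr => /eqP.
(* Both terms are nonnegative with sum zero, so [c |v|^2] vanishes, and [c > 0] forces [v = 0]. *)
rewrite paddr_eq0; last 2 first.
- by apply: sumr_ge0 => j _; apply: sumr_ge0 => i _; exact: sqr_ge0.
- by rewrite mulr_ge0 ?(ltW c0)// sumr_ge0 // => i _; exact: sqr_ge0.
case/andP => _; rewrite mulf_eq0 gt_eqF //= psumr_eq0 => [|i _]; last exact: sqr_ge0.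
move/allP => v0; apply/rowP => i; rewrite mxE; apply/eqP.
by move: (v0 i (mem_index_enum i)); rewrite sqrf_eq0.
Qed.
End KroneckerSum.

(** * The one-dimensional matrices and the odd extension *)

Section OneDimension.
Variable R : realType.

(** [F] lives on all naturals so that [a] may fall outside the summation range, where the last
    factor is zero. *)
Lemma sum_delta (S : pzSemiRingType) (n : nat) (F : nat -> S) (a : nat) :
  \sum_(k < n) F k * (k == a :> nat)%:R = F a * (a < n)%:R.
Proof.
rewrite -(big_mkord predT (fun k => F k * (k == a)%:R)).
under eq_bigr => k _ do rewrite mulr_natr mulrb.
rewrite -big_mkcond /= big_nat1_eq leq0n /=.
by case: ltnP; rewrite (mulr1, mulr0).
Qed.

Lemma scale_step (m : nat) : 1 / step R m ^+ 2 = m%:R ^+ 2.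
Proof. by rewrite /step !div1r exprVn invrK. Qed.

Definition cycle_pred (M i : nat) : nat := if i is i'.+1 then i' else M.-1.

(** Sends [v] to its cyclic forward differences [v_(k+1) - v_k]. *)
Definition cyclic_diff (M : nat) : 'M[R]_M :=
  \matrix_(k, i) ((k == cycle_pred M i :> nat)%:R - (k == i :> nat)%:R).

(** Separate deltas stay correct for [m = 1], where the corner entries add to the off-diagonal
    ones. *)
Lemma T_P_entry (m : nat) (i j : 'I_(2 * m)) :
  T_P R m i j = m%:R ^+ 2 *
   (2 * (i == j :> nat)%:R - (i.+1 == j :> nat)%:R - (i == j.+1 :> nat)%:R
    - ((i == 0 :> nat) && (j.+1 == 2 * m)%N)%:R
    - ((i.+1 == 2 * m)%N && (j == 0 :> nat))%:R).
Proof.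
rewrite /T_P scale_step !mxE !big_ord1 !mxE; congr (_ * _).
rewrite -!natrM !mulnb !eqSS; congr (_ - _ - _).
rewrite -val_eqE /= [i == j.+1 :> nat]eq_sym.
by (do 3 case: eqP => ? /=); try lia; ring.
Qed.

Lemma T_D_entry (m : nat) (i j : 'I_m.-1) :
  T_D R m i j = m%:R ^+ 2 *
   (2 * (i == j :> nat)%:R - (i.+1 == j :> nat)%:R - (i == j.+1 :> nat)%:R).
Proof.
rewrite /T_D scale_step !mxE; congr (_ * _).
rewrite -val_eqE /= [i == j.+1 :> nat]eq_sym.
by (do 3 case: eqP => ? /=); try lia; ring.
Qed.

Lemma T_P_gram (m : nat) :
  T_P R m = (m%:R *: cyclic_diff (2 * m))^T *m (m%:R *: cyclic_diff (2 * m)).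
Proof.
apply/matrixP => i j; rewrite T_P_entry -scalemxAr [(_ *: _)^T]linearZ /= -scalemxAl scalerA.
rewrite 2!mxE -expr2; congr (_ * _); set M := (2 * m)%N in i j *.
pose F (k : nat) : R := (k == cycle_pred M j)%:R - (k == j :> nat)%:R.
(* [F] is column [j] of the difference matrix; its inner product with column [i], a difference of
   two deltas, picks out these two values. *)
transitivity (F (cycle_pred M i) - F i).
  rewrite /F /cycle_pred; have := ltn_ord i; have := ltn_ord j.
  case: (nat_of_ord i) => [|a]; case: (nat_of_ord j) => [|b] /=;
  repeat (case: eqP => ? /=; try lia); move=> *; ring.
have pM : (cycle_pred M i < M)%N by case: (nat_of_ord i) (ltn_ord i) => /=; lia.
transitivity (F (cycle_pred M i) * (cycle_pred M i < M)%:R - F i * (i < M)%:R).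
  by rewrite pM ltn_ord !mulr1.
rewrite -!sum_delta -sumrB; apply: eq_bigr => k _.
by rewrite !mxE -mulrBr mulrC.
Qed.

(** Index [i] stands for grid point [i + 1], whose mirror point [2 m - (i + 1)] has index
    [2 m - i - 2]. *)
Lemma odd_ext_entry (m : nat) (r : 'I_(2 * m)) (i : 'I_m.-1) :
  odd_ext R m r i = (r == i :> nat)%:R - (r == (2 * m - i.+2)%N :> nat)%:R.
Proof.
rewrite !mxE eqSS; congr (_ - (nat_of_bool _)%:R).
by have := ltn_ord i; lia.
Qed.

(** The indices [i < m - 1] and their mirrors, all at least [m], are disjoint, so the columns of
    [odd_ext] are orthogonal with squared norm 2. *)
Lemma odd_restrK (m : nat) : odd_restr R m *m odd_ext R m = 1%:M.
Proof.
apply/matrixP => i j; rewrite /odd_restr -scalemxAl !mxE.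
have := ltn_ord i; have := ltn_ord j => jm im.
pose F (k : nat) : R := (k == j :> nat)%:R - (k == (2 * m - j.+2)%N)%:R.
transitivity (2^-1 * \sum_(k < 2 * m) (
    F k * (k == i :> nat)%:R -
    F k * (k == (2 * m - i.+2)%N :> nat)%:R)).
  congr (_ * _); apply: eq_bigr => k _; rewrite mxE !odd_ext_entry /F; ring.
rewrite sumrB !sum_delta.
have -> : (i < 2 * m)%N by lia.
have -> : (2 * m - i.+2 < 2 * m)%N by lia.
rewrite -val_eqE /= /F.
case: (eqVneq (i : nat) j) => [->|ij].
  do 3 case: eqP => ? /=; try lia; by field.
do 3 case: eqP => ? /=; try lia; by field.
Qed.

(** The periodic second difference commutes with reflection, and an odd function vanishes at the
    fixed indices [m - 1] and [2 m - 1], which supplies the Dirichlet boundary values. *)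
Lemma T_odd_ext (m : nat) : T_P R m *m odd_ext R m = odd_ext R m *m T_D R m.
Proof.
apply/matrixP => r i; rewrite !mxE.
have := ltn_ord i; have := ltn_ord r => rm im.
pose P (a k : nat) : R := m%:R ^+ 2 *
   (2 * (a == k :> nat)%:R - (a.+1 == k :> nat)%:R - (a == k.+1 :> nat)%:R
    - ((a == 0 :> nat) && (k.+1 == 2 * m)%N)%:R
    - ((a.+1 == 2 * m)%N && (k == 0 :> nat))%:R).
pose D (k : nat) : R := m%:R ^+ 2 *
   (2 * (k == i :> nat)%:R - (k.+1 == i :> nat)%:R - (k == i.+1 :> nat)%:R).
(* [r'] is the mirror image of [r]; its value [m] at the fixed point
   [r = 2 * m - 1] lies outside the Dirichlet grid. *)
pose r' := if r.+1 == (2 * m)%N then m else (2 * m - r.+2)%N.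
(* Column [i] of the extension leaves two terms of the left sum; row [r] leaves at most two of the
   right sum, at [r] and [r'] when they lie in the Dirichlet grid. *)
transitivity (P r i - P r (2 * m - i.+2)%N); last transitivity
  (D r * (r < m.-1)%:R - D r' * (r' < m.-1)%:R).
- have [i1 i2] : (i < 2 * m)%N /\ (2 * m - i.+2 < 2 * m)%N by lia.
  transitivity (P r i * (i < 2 * m)%:R
    - P r (2 * m - i.+2)%N * (2 * m - i.+2 < 2 * m)%:R); last by rewrite i1 i2 !mulr1.
  rewrite -!(sum_delta _ (P r)) -sumrB.
  apply: eq_bigr => k _; rewrite T_P_entry odd_ext_entry /P; ring.
- rewrite /P /D /r' {P D r'}.
  case: (ltnP r m.-1) => r1; case: (r.+1 =P (2 * m)%N) => r2; try lia;
  case: ltnP => r3; try lia; rewrite ?mulr1 ?mulr0;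
  repeat (case: eqP => ? /=; try lia); move=> *; ring.
- rewrite -!(sum_delta _ D) -sumrB; apply: eq_bigr => k _.
  rewrite odd_ext_entry T_D_entry -mulrBr mulrC /D; congr (_ * _).
  rewrite eq_sym; congr (_ - (nat_of_bool _)%:R).
  by have := ltn_ord k; rewrite /r'; case: (r.+1 =P (2 * m)%N) => ?; lia.
Qed.
End OneDimension.

(** * Compatibility as intertwining, and the system matrices *)

Section Compatibility.
Variable R : realType.

Lemma odd_restr_ntensK (d m : nat) : odd_restr R m ^t d *m odd_ext R m ^t d = 1%:M.
Proof. by rewrite ntensmx_mul odd_restrK ntensmx_id. Qed.

(** Extension after restriction is the identity on the range of the extension, so stability of that
    range turns [LD = R LP E] into [E LD = LP E]; the converse uses [R E = 1]. *)
Lemma lfa_compatibleP (d m m' : nat)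
    (LD : 'M[R]_(m'.-1 ^ d, m.-1 ^ d)) (LP : 'M[R]_((2 * m') ^ d, (2 * m) ^ d)) :
  lfa_compatible LD LP <-> LP *m odd_ext R m ^t d = odd_ext R m' ^t d *m LD.
Proof.
split=> [[-> stable]|LPE]; last first.
  split; first by rewrite -mulmxA LPE mulmxA odd_restr_ntensK mul1mx.
  by move=> _ [w ->]; exists (LD *m w); rewrite mulmxA LPE mulmxA.
(* The equality is checked column by column, applying stability to the extension of each basis
   vector. *)
apply: trmx_inj; apply/row_matrixP => j; rewrite -!tr_col !colE; congr (_^T).
have [|w LPw] := stable (odd_ext R m ^t d *m delta_mx j 0); first by eexists.
rewrite -!mulmxA LPw; congr (_ *m _).
by rewrite mulmxA odd_restr_ntensK mul1mx.
Qed.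

Lemma A_intertwine (d m : nat) (c : R) :
  A_P d c m *m odd_ext R m ^t d = odd_ext R m ^t d *m A_D d c m.
Proof. exact/kron_sum_intertwine/T_odd_ext. Qed.

Lemma A_P_unitmx (d m : nat) (c : R) : 0 < c -> A_P d c m \in unitmx.
Proof. by move=> c0; rewrite /A_P T_P_gram; exact: kron_sum_gram_unitmx. Qed.

(** Invertibility descends from the periodic matrix: the compression of its inverse to odd functions
    is a left inverse of [A_D]. *)
Lemma A_D_unitmx (d m : nat) (c : R) : 0 < c -> A_D d c m \in unitmx.
Proof.
move=> /(A_P_unitmx d m) uP.
suff /mulmx1_unit[] : odd_restr R m ^t d *m invmx (A_P d c m) *m odd_ext R m ^t d
    *m A_D d c m = 1%:M by [].
by rewrite -mulmxA -A_intertwine -!mulmxA (mulmxA (invmx _)) mulVmx // mul1mx odd_restr_ntensK.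
Qed.
End Compatibility.

(** * Closure of intertwining under the matrix operations *)

Section Intertwining.
Variable R : comUnitRingType.

Lemma mulmx_intertwine (a b p q s t : nat) (LP : 'M[R]_(a, b)) (KP : 'M[R]_(b, s))
    (LD : 'M[R]_(p, q)) (KD : 'M[R]_(q, t)) (E1 : 'M[R]_(a, p)) (E2 : 'M[R]_(b, q))
    (E3 : 'M[R]_(s, t)) :
  LP *m E2 = E1 *m LD -> KP *m E3 = E2 *m KD ->
  (LP *m KP) *m E3 = E1 *m (LD *m KD).
Proof. by move=> LE KE; rewrite -mulmxA KE mulmxA LE mulmxA. Qed.

Lemma sub1_intertwine (a p : nat) (LP : 'M[R]_a) (LD : 'M[R]_p) (E : 'M[R]_(a, p)) :
  LP *m E = E *m LD -> (1%:M - LP) *m E = E *m (1%:M - LD).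
Proof. by move=> LE; rewrite mulmxBl mulmxBr mul1mx mulmx1 LE. Qed.

Lemma invmx_intertwine (a p : nat) (LP : 'M[R]_a) (LD : 'M[R]_p) (E : 'M[R]_(a, p)) :
  LP \in unitmx -> LD \in unitmx -> LP *m E = E *m LD ->
  invmx LP *m E = E *m invmx LD.
Proof.
by move=> uP uD LE; rewrite -[E in LHS](mulmxK uD) -LE -!mulmxA mulKmx.
Qed.
End Intertwining.

(** * Induction over the grid levels *)

Section Multigrid.
Variable R : realType.

Lemma multigrid_intertwine (NP ND : nat -> nat)
    (AP SP : forall k, 'M[R]_(NP k)) (AD SD : forall k, 'M[R]_(ND k))
    (rP : forall k, 'M[R]_(NP k, NP k.+1)) (rD : forall k, 'M[R]_(ND k, ND k.+1))
    (pP : forall k, 'M[R]_(NP k.+1, NP k)) (pD : forall k, 'M[R]_(ND k.+1, ND k))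
    (E : forall k, 'M[R]_(NP k, ND k)) (K : nat) :
  (forall k, AP k \in unitmx) -> (forall k, AD k \in unitmx) ->
  (forall k, AP k *m E k = E k *m AD k) ->
  (forall k, (0 < k <= K)%N -> SP k *m E k = E k *m SD k) ->
  (forall k, (k < K)%N -> rP k *m E k.+1 = E k *m rD k) ->
  (forall k, (k < K)%N -> pP k *m E k = E k.+1 *m pD k) ->
  multigrid AP SP rP pP K *m E K = E K *m multigrid AD SD rD pD K.
Proof.
move=> uP uD AE; elim: K => [|K IHK] SE rE pE /=; first exact: invmx_intertwine.
apply: mulmx_intertwine; last exact: invmx_intertwine.
apply: sub1_intertwine; apply: mulmx_intertwine; apply: sub1_intertwine.
  (* Coarse-grid correction: the factors [A] and restriction are peeled off from the right, leaving
     the prolongation and the coarser iterator. *)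
  do 2 (apply: mulmx_intertwine; last by [exact: AE | exact: rE]).
  apply: mulmx_intertwine; first exact: pE.
  (* The bounds on [k] for level [K] are weaker demands than those assumed for [K.+1]. *)
  apply: IHK => k kK; [apply: SE | apply: rE | apply: pE]; lia.
by apply: mulmx_intertwine; [apply: SE; rewrite leqnn | exact: AE].
Qed.
End Multigrid.

(** With [n = 2 ^ K], level [K] is the finest grid; the hypotheses on smoothers and transfers cover
    every level that the recursion visits. *)
Theorem theorem3p2 (R : realType) (d K : nat) (c : R)
  (hd : (1 <= d)%N) (hc : 0 < c) (hn : (2 <= 2 ^ K)%N)
  (S_D : forall k, 'M[R]_((2 ^ k).-1 ^ d))
  (S_P : forall k, 'M[R]_((2 * 2 ^ k) ^ d))
  (restr_D : forall k, 'M[R]_((2 ^ k).-1 ^ d, (2 ^ k.+1).-1 ^ d))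
  (restr_P : forall k, 'M[R]_((2 * 2 ^ k) ^ d, (2 * 2 ^ k.+1) ^ d))
  (prol_D : forall k, 'M[R]_((2 ^ k.+1).-1 ^ d, (2 ^ k).-1 ^ d))
  (prol_P : forall k, 'M[R]_((2 * 2 ^ k.+1) ^ d, (2 * 2 ^ k) ^ d))
  (hA : lfa_compatible (A_D d c (2 ^ K)) (A_P d c (2 ^ K)))
  (hA2 : lfa_compatible (invmx (A_D d c (2 ^ K.-1)))
                        (invmx (A_P d c (2 ^ K.-1))))
  (hS : forall k, (0 < k <= K)%N -> lfa_compatible (S_D k) (S_P k))
  (hprol : forall k, (k < K)%N -> lfa_compatible (prol_D k) (prol_P k))
  (hrestr : forall k, (k < K)%N -> lfa_compatible (restr_D k) (restr_P k)) :
  lfa_compatible (B_D c S_D restr_D prol_D K) (B_P c S_P restr_P prol_P K).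
Proof.
apply/lfa_compatibleP.
apply: (multigrid_intertwine (E := fun k => odd_ext R (2 ^ k) ^t d)) => k *.
- exact: A_P_unitmx.
- exact: A_D_unitmx.
- exact: A_intertwine.
- exact/lfa_compatibleP/hS.
- exact/lfa_compatibleP/hrestr.
- exact/lfa_compatibleP/hprol.
Qed.
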